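(* Let $T$ be a labelled tree on $n$ vertices and let $A\in M_n(\mathbb{R})$ be such that $A$ is totally positive relative to $T$ (T-TP), the principal submatrices of $A$ associated with deletion of pendent vertices of $T$ are P-matrices, and $\det A>0$. Then the eigenvalue $\lambda$ of $A$ of smallest absolute value is positive with multiplicity 1 (so $\lambda>0$ is real and simple and every other complex eigenvalue $\mu$ of $A$ satisfies $|\mu|>\lambda$), and its eigenvector is signed according to $T$: there is an eigenvector $x\in\mathbb{R}^n$ of $A$ for $\lambda$ with $\sigma_i x_i>0$ for all $i=1,\dots,n$, where $\sigma=(\sigma_1,\dots,\sigma_n)$ is signed according to $T$.
   Context: A labelled tree $T$ on $n$ vertices has vertex set $\{1,\dots,n\}$. A pendent vertex is a vertex of degree 1. A real square matrix is totally positive (TP) if all its minors are positive, and is a P-matrix if all its principal minors are positive. For an ordered index list $\alpha$ of distinct elements of $\{1,\dots,n\}$, $A[\alpha]$ is the principal submatrix of $A$ with rows and columns indexed by $\alpha$, arranged in the order given by $\alpha$. For a path $\mathscr{P}$ in $T$, $A[\mathscr{P}]$ means $A[\alpha]$ where $\alpha$ lists the vertices of $\mathscr{P}$ in the order in which they appear along $\mathscr{P}$ (the direction is immaterial). $A\in M_n(\mathbb{R})$ is T-TP if $A[\mathscr{P}]$ is TP for each path $\mathscr{P}$ of $T$ connecting two pendent vertices. The principal submatrices associated with deletion of pendent vertices are the matrices $A(p)$, for $p$ a pendent vertex of $T$, obtained from $A$ by deleting row $p$ and column $p$. A vector $\sigma\in\{1,-1\}^n$ is signed according to $T$ if $\sigma_i=-\sigma_j$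 whenever $i$ and $j$ are adjacent in $T$; such $\sigma$ is unique up to multiplication by $\pm1$. *)

(* Defs.v *)
From mathcomp Require Import all_boot all_order all_algebra.
From mathcomp Require Import reals.
From mathcomp Require Import complex.

Set Implicit Arguments.
Unset Strict Implicit.
Unset Printing Implicit Defensive.

Import Order.TTheory GRing.Theory Num.Theory.
Local Open Scope ring_scope.

(* Vertices are labelled by 'I_n, i.e. 0, ..., n-1; [e] is the adjacency
   relation.  A cycle of a simple graph has at least three vertices, whereas
   [ucycle] also accepts an edge traversed back and forth. *)
Definition is_tree (n : nat) (e : rel 'I_n) : Prop :=
  [/\ (0 < n)%N,
      symmetric e,
      irreflexive e,
      (forall i j, connect e i j)
    & (forall c : seq 'I_n, (2 < size c)%N -> ~ ucycle e c)].

Definition pendent (n : nat) (e : rel 'I_n) (p : 'I_n) : Prop :=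
  #|[set q | e p q]| = 1%N.

(* Minors are indexed by strictly increasing selections of rows and columns;
   the empty minor (k = 0) is 1. *)
Definition increasing (k m : nat) (f : 'I_k -> 'I_m) : Prop :=
  forall i j : 'I_k, (i < j)%N -> (f i < f j)%N.

Definition totally_positive (R : realType) (m : nat) (A : 'M[R]_m) : Prop :=
  forall (k : nat) (f g : 'I_k -> 'I_m),
    increasing f -> increasing g -> 0 < \det (mxsub f g A).

Definition P_matrix (R : realType) (m : nat) (A : 'M[R]_m) : Prop :=
  forall (k : nat) (f : 'I_k -> 'I_m),
    increasing f -> 0 < \det (mxsub f f A).

(* A[alpha], with rows and columns arranged in the order of the list alpha *)
Definition princ_sub (R : realType) (n : nat) (A : 'M[R]_n)
    (alpha : seq 'I_n) : 'M[R]_(size alpha) :=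
  mxsub (tnth (in_tuple alpha)) (tnth (in_tuple alpha)) A.

(* The vertex list [p :: s] ranges over both orientations of each path. *)
Definition T_TP (R : realType) (n : nat) (e : rel 'I_n) (A : 'M[R]_n) : Prop :=
  forall (p : 'I_n) (s : seq 'I_n),
    path e p s -> uniq (p :: s) ->
    pendent e p -> pendent e (last p s) -> p != last p s ->
    totally_positive (princ_sub A (p :: s)).

Definition delete_vertex (R : realType) (n : nat) (A : 'M[R]_n) (p : 'I_n) :
    'M[R]_n.-1 :=
  row' p (col' p A).

Definition signed_according (R : realType) (n : nat) (e : rel 'I_n)
    (sigma : 'cV[R]_n) : Prop :=
  (forall i, sigma i 0 = 1 \/ sigma i 0 = -1) /\
  (forall i j, e i j -> sigma i 0 = - sigma j 0).

Definition complexify (R : realType) (n : nat) (A : 'M[R]_n) : 'M[R[i]]_n :=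
  map_mx (real_complex R) A.

(* Main.v *)
Require Import Defs.
From mathcomp Require Import all_boot all_order all_algebra.
From mathcomp Require Import reals.
From mathcomp Require Import complex.
From mathcomp Require Import zify ring lra.

Import Order.TTheory GRing.Theory Num.Theory.
Local Open Scope ring_scope.
Local Open Scope complex_scope.

Set Implicit Arguments.
Unset Strict Implicit.
Unset Printing Implicit Defensive.

(** The inverse of A is signed by the tree: with sigma signed according to T,
sigma_i (A^-1)_ij sigma_j > 0 for all i and j. Perron's theory for the
positive matrix D A^-1 D, where D is the diagonal matrix of sigma, then gives
the smallest eigenvalue of A as the inverse of the Perron root.

The sign pattern is proved for the principal submatrices A[S] of all subtrees
S that are either the whole tree or miss a pendent vertex, by induction on S
(subtree_inverse_positive). The hypotheses on det A and on the deletion of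
pendent vertices give det A[S] > 0 for these S, which makes the diagonal of
every inverse positive. There are three cases.
 - S is a single vertex: the determinant suffices.
 - S is a path: it is part of a path between pendent vertices, so A[S] is
   totally positive and its inverse has a checkerboard pattern.
 - S has three leaves q1, q2 and r. Let M = D A D and let w be column r of the
   inverse of M[S - q1 - q2], extended by zero; w is positive. On S, M w equals
   e_r + b1 e_q1 + b2 e_q2. Because w vanishes at q1, while the inverse of
   M[S - q2] is positive and maps e_r + b1 e_q1 to w, b1 must be negative, and
   likewise b2. Now if b is column r of the inverse of M[S], then b_r > 0, and
   the vector (w_r / b_r) b - w vanishes at r and is the solution on S - r of a
   system with right-hand side - b1 e_q1 - b2 e_q2 >= 0, hence is positive. So
   b is positive (inverse_positive_col). By transposition row r is positive as
   well, and the other entries follow from the Schur complement formula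
   (inverse_positive_step).

On the spectral side, a complex left eigenvector of a positive matrix G that
annihilates the positive eigenvector x for rho has its eigenvalue strictly
below rho in absolute value (eigenvalue_dominated). A left eigenvector for an
eigenvalue other than rho annihilates x, and if rho were a multiple root of the
characteristic polynomial there would be one for rho itself
(char_poly_deflate), so this gives both dominance and simplicity. *)

(** * Positive eigenvectors of positive matrices *)

Lemma mulmx_pos_gt0 (R : numDomainType) (n : nat) (G : 'M[R]_n)
    (z : 'cV[R]_n) :
  (forall i j, 0 < G i j) -> (forall i, 0 <= z i 0) -> z != 0 ->
  forall i, 0 < (G *m z) i 0.
Proof.
move=> G0 z0 zN i.
have Gz0 j : 0 <= G i j * z j 0 by rewrite mulr_ge0 // ltW.
rewrite mxE lt0r sumr_ge0 ?andbT //; apply: contra zN.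
rewrite psumr_eq0 // => /allP Gz; apply/eqP/matrixP => j k.
rewrite (ord1 k) mxE; have := Gz j (mem_index_enum j).
by rewrite /= mulf_eq0 gt_eqF //= => /eqP.
Qed.

Lemma col0P (R : numDomainType) (n : nat) (z : 'cV[R]_n) :
  (forall i, z i 0 = 0) -> z = 0.
Proof. by move=> z0; apply/matrixP => i j; rewrite (ord1 j) z0 mxE. Qed.

(** At an index where z i 0 / x i 0 is maximal, with maximum t, the vector
t *: x - z is nonnegative and vanishes, so G cannot map it to something
negative there. *)
Lemma subinvariant_eq0 (R : realFieldType) (n : nat) (G : 'M[R]_n) (s : R)
    (x z : 'cV[R]_n) :
  (forall i j, 0 <= G i j) -> (forall i, 0 < x i 0) ->
  (forall i, (G *m x) i 0 < s * x i 0) ->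
  (forall i, 0 <= z i 0) -> (forall i, s * z i 0 <= (G *m z) i 0) ->
  z = 0.
Proof.
move=> G0 x0 Gx z0 Gz; apply/col0P => k; apply/eqP; rewrite eq_le z0 andbT.
rewrite leNgt; apply/negP => zk.
pose f i := z i 0 / x i 0.
case: (@arg_maxP _ _ _ k xpredT f isT) => i _ imax.
have fi : 0 < f i by apply: lt_le_trans (imax k isT); rewrite divr_gt0.
have zi : z i 0 = f i * x i 0 by rewrite /f divfK // gt_eqF.
have : (G *m z) i 0 <= f i * (G *m x) i 0.
  rewrite !mxE mulr_sumr ler_sum // => j _; rewrite mulrCA ler_wpM2l //.
  by rewrite -ler_pdivrMr //; apply: imax.
move/(le_trans (Gz i)); rewrite zi mulrCA ler_pM2l // leNgt.
by rewrite Gx.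
Qed.

Lemma le_mulmx_norm (R : numDomainType) (n : nat) (G : 'M[R]_n)
    (v : 'cV[R]_n) (i : 'I_n) :
  (forall i j, 0 <= G i j) ->
  `|(G *m v) i 0| <= (G *m (\col_j `|v j 0|)) i 0.
Proof.
move=> G0; rewrite !mxE; apply: le_trans (ler_norm_sum _ _ _) _.
by apply: ler_sum => j _; rewrite mxE normrM ger0_norm.
Qed.

Lemma resolvent_unit (R : realFieldType) (n : nat) (G : 'M[R]_n) (s : R)
    (x : 'cV[R]_n) :
  (forall i j, 0 <= G i j) -> (forall i, 0 < x i 0) ->
  (forall i, (G *m x) i 0 < s * x i 0) -> s%:M - G \in unitmx.
Proof.
move=> G0 x0 Gx; rewrite -unitmx_tr unitmxE unitfE; apply/det0P => -[u uN].
rewrite -[u]trmxK -trmx_mul => /(congr1 trmx); rewrite trmx0 trmxK mulmxBl.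
rewrite mul_scalar_mx => /eqP; rewrite subr_eq0 => /eqP Gu.
have /matrixP abs0 : \col_j `|u^T j 0| = 0.
  apply: (subinvariant_eq0 G0 x0 Gx) => i; first by rewrite mxE.
  apply: le_trans (le_mulmx_norm _ _ G0); rewrite -Gu !mxE normrM.
  by rewrite ler_wpM2r ?ler_norm.
case/eqP: uN; apply/matrixP => i j; have := abs0 j 0.
by rewrite !mxE (ord1 i) => /eqP; rewrite normr_eq0 => /eqP.
Qed.

(** The negative part of v satisfies the hypotheses of subinvariant_eq0. *)
Lemma resolvent_ge0 (R : realFieldType) (n : nat) (G : 'M[R]_n) (s : R)
    (x v : 'cV[R]_n) :
  (forall i j, 0 <= G i j) -> (forall i, 0 < x i 0) ->
  (forall i, (G *m x) i 0 < s * x i 0) ->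
  (forall i, (G *m v) i 0 <= s * v i 0) -> forall i, 0 <= v i 0.
Proof.
move=> G0 x0 Gx Gv i.
have /matrixP neg0 : \col_j (Num.max 0 (- v j 0)) = 0.
  apply: (subinvariant_eq0 G0 x0 Gx) => k; first by rewrite mxE le_max lexx.
  rewrite [X in _ * X]mxE; case: (leP (- v k 0) 0) => vk.
    rewrite mulr0 mxE sumr_ge0 // => j _.
    by rewrite mulr_ge0 // mxE le_max lexx.
  rewrite mulrN lerNl; apply: le_trans (Gv k).
  rewrite !mxE -sumrN ler_sum // => j _.
  by rewrite -mulrN ler_wpM2l // mxE lerNl le_max lexx orbT.
have := neg0 i 0; rewrite !mxE => /eqP.
by rewrite eq_le ge_max lexx /= oppr_le0 => /andP[].
Qed.

Lemma sum_ge_term (R : numDomainType) (I : finType) (F : I -> R) (i : I) :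
  (forall j, 0 <= F j) -> F i <= \sum_j F j.
Proof. by move=> F0; rewrite (bigD1 i) //= lerDl sumr_ge0. Qed.

(** As t decreases to s, the solutions of (t - G) x = 1 stay bounded because
s - G is invertible; for t close to s the term (t - s) x is thus negligible
against 1, and x still satisfies G x < s' x for some s' < s. *)
Lemma superinvariant_lower (R : realFieldType) (n : nat) (G : 'M[R]_n) (s : R) :
  (forall i j, 0 < G i j) -> 0 <= s ->
  (forall t, s < t -> exists x : 'cV[R]_n, (forall i, 0 < x i 0) /\
     forall i, (G *m x) i 0 < t * x i 0) ->
  s%:M - G \in unitmx ->
  exists t (x : 'cV[R]_n), [/\ t < s, forall i, 0 < x i 0
     & forall i, (G *m x) i 0 < t * x i 0].
Proof.
move=> Gp s0 good sU.
have G0 i j : 0 <= G i j by apply: ltW.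
set C := invmx (s%:M - G).
(* K bounds C in norm, so that m <= K (1 + d m) below; d = 1 / (4 K) turns
   this into d m <= 1 / 3. *)
pose K := 1 + \sum_i \sum_j `|C i j|.
have K1 : 1 <= K by rewrite lerDl sumr_ge0 // => i _; rewrite sumr_ge0.
have K0 : 0 < K by apply: lt_le_trans K1.
have K4 : 0 < 4 * K by rewrite mulr_gt0.
pose d := (4 * K)^-1.
have d0 : 0 < d by rewrite invr_gt0.
have [y [y0 Gy]] := good (s + d) ltac:(by rewrite ltrDl).
have [x xE] : exists x : 'cV[R]_n, ((s + d)%:M - G) *m x = const_mx 1.
  exists (invmx ((s + d)%:M - G) *m const_mx 1).
  by rewrite mulKVmx // (resolvent_unit G0 y0 Gy).
have Gx i : (G *m x) i 0 = (s + d) * x i 0 - 1.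
  have /matrixP/(_ i 0) := xE; rewrite mulmxBl mul_scalar_mx !mxE => <-.
  by rewrite subKr.
have x0 : forall i, 0 <= x i 0.
  by apply: (resolvent_ge0 G0 y0 Gy) => i; rewrite Gx lerBlDr lerDl ler01.
have xp i : 0 < x i 0.
  rewrite lt0r x0 andbT; apply/eqP => xi0.
  have : 0 <= (G *m x) i 0 by rewrite mxE sumr_ge0 // => j _; rewrite mulr_ge0.
  by rewrite Gx xi0 mulr0 sub0r oppr_ge0 ler10.
pose m := \sum_i x i 0.
have xm i : x i 0 <= m by apply: (sum_ge_term (F := fun i => x i 0)).
have m0 : 0 <= m by rewrite sumr_ge0.
have xC : x = C *m (const_mx 1 - d *: x).
  have : (s%:M - G) *m x = const_mx 1 - d *: x.
    rewrite -xE -mul_scalar_mx -mulmxBl raddfD /=; congr (_ *m x).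
    by rewrite [RHS]addrAC addrK.
  by move=> <-; rewrite mulKmx.
have mK : m <= K * (1 + d * m).
  rewrite /K mulrDl mulr_suml mul1r; apply: ler_wpDl.
    by rewrite addr_ge0 // mulr_ge0 // ltW.
  apply: ler_sum => i _; rewrite {1}xC mxE mulr_suml; apply: ler_sum => j _.
  rewrite !mxE (le_trans (ler_norm _)) // normrM ler_wpM2l //.
  rewrite (le_trans (ler_normB _ _)) // normr1 lerD2l normrM.
  by rewrite (gtr0_norm d0) (ger0_norm (x0 j)) ler_pM2l.
have dm : d * m <= 1 / 3.
  have dK : d * K = 1 / 4 by rewrite /d; field; rewrite gt_eqF.
  have : d * m <= d * (K * (1 + d * m)) by rewrite ler_pM2l.
  by rewrite mulrA dK; lra.
have m1 : 0 < 1 + m by rewrite ltr_wpDr.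
pose d' := (2 * (1 + m))^-1.
have d'0 : 0 < d' by rewrite invr_gt0 mulr_gt0.
exists (s - d'), x; split => //; first by rewrite ltrBlDr ltrDl.
move=> i; rewrite Gx.
have : d * x i 0 <= d * m by rewrite ler_pM2l.
have : d' * x i 0 <= d' * m by rewrite ler_pM2l.
have : d' * m = 1 / 2 - d' by rewrite /d'; field; rewrite gt_eqF.
by move: dm d'0; lra.
Qed.

(** Let s0 be the infimum of the s for which some x > 0 satisfies G x < s x.
By superinvariant_lower, s0 - G is singular. For v <> 0 in its kernel, then
z = |v| satisfies s0 z <= G z, and equality holds: otherwise G z would satisfy
(s0 + d) G z <= G (G z) for some d > 0, against subinvariant_eq0. *)
Theorem perron_exists (R : realType) (n : nat) (G : 'M[R]_n) :
  (0 < n)%N -> (forall i j, 0 < G i j) ->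
  exists (rho : R) (x : 'cV[R]_n),
    [/\ 0 < rho, forall i, 0 < x i 0 & G *m x = rho *: x].
Proof.
move=> n0 Gp; have G0 i j : 0 <= G i j by apply: ltW.
pose super s := exists x : 'cV[R]_n, (forall i, 0 < x i 0) /\
  forall i, (G *m x) i 0 < s * x i 0.
have super_ge0 s : super s -> 0 <= s.
  move=> [x [x0 Gx]]; pose i := Ordinal n0.
  have : 0 <= (G *m x) i 0.
    by rewrite mxE sumr_ge0 // => j _; rewrite mulr_ge0 // ltW.
  by move/le_lt_trans/(_ (Gx i)); rewrite pmulr_lgt0 // => /ltW.
have superW s t : s <= t -> super s -> super t.
  move=> st [x [x0 Gx]]; exists x; split=> // i.
  by apply: lt_le_trans (Gx i) _; rewrite ler_pM2r.
have superI : super (1 + \sum_i \sum_j G i j).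
  exists (const_mx 1); split=> i; rewrite !mxE // mulr1.
  rewrite -[ltLHS]add0r ltr_leD //; under eq_bigr do rewrite mxE mulr1.
  by apply: (sum_ge_term (F := fun i => \sum_j G i j)) => k; rewrite sumr_ge0.
pose s0 := inf super.
have super_lb : classical_sets.has_lbound super by exists 0 => s /super_ge0.
have super_s0 s : super s -> s0 <= s by move=> sup; apply: ge_inf.
have s0_ge0 : 0 <= s0.
  by apply: lb_le_inf; [exists (1 + \sum_i \sum_j G i j) | move=> s /super_ge0].
have s0_super t : s0 < t -> super t.
  move=> s0t; have [|s /= sup st] := inf_lt _ s0t.
    by exists (1 + \sum_i \sum_j G i j).
  exact: superW (ltW st) sup.
have [sU | ] := boolP (s0%:M - G \in unitmx).
  have [t [x [ts x0 Gx]]] := superinvariant_lower Gp s0_ge0 s0_super sU.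
  by have := super_s0 t (ex_intro _ x (conj x0 Gx)); rewrite leNgt ts.
rewrite -unitmx_tr unitmxE unitfE negbK => /det0P[u uN].
rewrite -[u]trmxK -trmx_mul => /(congr1 trmx); rewrite trmx0 trmxK mulmxBl.
rewrite mul_scalar_mx => /eqP; rewrite subr_eq0 => /eqP Gu.
pose z := \col_j `|u^T j 0|.
have z0 i : 0 <= z i 0 by rewrite mxE.
have zN : z != 0.
  apply: contra uN => /eqP/matrixP z00; apply/eqP/matrixP => i j.
  have := z00 j 0; rewrite !mxE (ord1 i) => /eqP.
  by rewrite normr_eq0 => /eqP.
have Gz i : 0 <= (G *m z - s0 *: z) i 0.
  rewrite mxE [X in _ + X]mxE subr_ge0; apply: le_trans (le_mulmx_norm _ _ G0).
  by rewrite -Gu !mxE normrM (ger0_norm s0_ge0).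
have Gzp := mulmx_pos_gt0 Gp z0 zN.
have [Gz0 | GzN] := eqVneq (G *m z - s0 *: z) 0.
  have {}Gz0 : G *m z = s0 *: z by apply/eqP; rewrite -subr_eq0 Gz0.
  have s0z i : 0 < s0 * z i 0 by have := Gzp i; rewrite Gz0 mxE.
  exists s0, z; split=> //.
    rewrite lt0r s0_ge0 andbT; apply: contraTN (s0z (Ordinal n0)) => /eqP ->.
    by rewrite mul0r ltxx.
  move=> i; rewrite lt0r z0 andbT; apply: contraTN (s0z i) => /eqP ->.
  by rewrite mulr0 ltxx.
(* g k is the largest d with (s0 + d) G z <= G (G z) *)
have G2 := mulmx_pos_gt0 Gp Gz GzN.
pose g i := (G *m (G *m z - s0 *: z)) i 0 / (G *m z) i 0.
have g0 i : 0 < g i by rewrite divr_gt0.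
case: (@arg_minP _ _ _ (Ordinal n0) xpredT g isT) => k _ kmin.
have [x [x0 Gx]] := s0_super (s0 + g k) ltac:(by rewrite ltrDl).
have /matrixP/(_ k 0) : G *m z = 0.
  apply: (subinvariant_eq0 G0 x0 Gx) => i; first exact: ltW.
  have := kmin i isT; rewrite [g i]/g ler_pdivlMr // mulmxBr -scalemxAr.
  rewrite [X in _ <= X]mxE [X in _ <= _ + X]mxE [X in _ <= _ - X]mxE mulrDl.
  by move=> ?; lra.
by move/eqP; rewrite [X in _ == X]mxE gt_eqF.
Qed.

(** * Simplicity and dominance *)

(** Since w annihilates x, the entries G i j of column j may be lowered by
e * x i 0, for a small e > 0, without changing w *m G; the triangle inequality
applied to the lowered column is then strict against G. *)
Lemma eigenvalue_dominated (C : numFieldType) (n : nat) (G : 'M[C]_n)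
    (x : 'cV[C]_n) (w : 'rV[C]_n) (rho mu : C) :
  (forall i j, 0 < G i j) -> (forall i, 0 < x i 0) -> G *m x = rho *: x ->
  w != 0 -> w *m G = mu *: w -> w *m x = 0 -> `|mu| < rho.
Proof.
move=> G0 x0 Gx wN wG wx.
have /existsP[k wk] : [exists k, w 0 k != 0].
  apply: contraR wN; rewrite negb_exists => /forallP w0.
  by apply/eqP/matrixP => i j; rewrite (ord1 i) mxE; apply/eqP/negPn/w0.
pose W := \sum_i `|w 0 i| * x i 0.
have W0 : 0 < W.
  rewrite /W (bigD1 k) //= ltr_wpDr ?mulr_gt0 ?normr_gt0 // sumr_ge0 // => i _.
  by rewrite mulr_ge0 // ltW.
have strict j : `|mu| * `|w 0 j| < \sum_i `|w 0 i| * G i j.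
  pose S := \sum_i x i 0 / G i j.
  have xG i : 0 <= x i 0 / G i j by rewrite divr_ge0 // ltW.
  have S0 : 0 < S.
    rewrite /S (bigD1 k) //= ltr_wpDr ?sumr_ge0 //.
    by rewrite divr_gt0.
  have low i : 0 <= G i j - S^-1 * x i 0.
    rewrite subr_ge0 mulrC ler_pdivrMr // mulrC -ler_pdivrMr //.
    by rewrite /S (bigD1 i) //= lerDl sumr_ge0.
  have wj : mu * w 0 j = \sum_i w 0 i * (G i j - S^-1 * x i 0).
    have /matrixP/(_ 0 j) := wG; rewrite !mxE => <-.
    have /matrixP/(_ 0 0) := wx; rewrite !mxE => wx0.
    under [RHS]eq_bigr do rewrite mulrBr mulrCA.
    by rewrite sumrB -mulr_sumr wx0 mulr0 subr0.
  rewrite -normrM wj; apply: le_lt_trans (ler_norm_sum _ _ _) _.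
  under eq_bigr do rewrite normrM (ger0_norm (low _)) mulrBr mulrCA.
  by rewrite sumrB -mulr_sumr ltrBlDr ltrDl mulr_gt0 // invr_gt0.
rewrite -(ltr_pM2r W0) {1}/W mulr_sumr.
have -> : rho * W = \sum_j (\sum_i `|w 0 i| * G i j) * x j 0.
  under eq_bigr do rewrite mulr_suml.
  rewrite exchange_big /= /W mulr_sumr; apply: eq_bigr => i _.
  have /matrixP/(_ i 0) := Gx; rewrite !mxE mulrCA => <-.
  by rewrite mulr_sumr; apply: eq_bigr => j _; rewrite mulrA.
apply: ltr_sum => [|j _].
  by apply/hasP; exists k; rewrite ?mem_index_enum.
by rewrite mulrA ltr_pM2r.
Qed.

(** In a basis starting with x the matrix becomes block upper triangular, and q
is the characteristic polynomial of the action on the quotient by x. A left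
eigenvector of this action is a left eigenvector of M annihilating x. *)
Lemma char_poly_deflate (F : fieldType) (n : nat) (M : 'M[F]_n)
    (x : 'cV[F]_n) (a : F) :
  (0 < n)%N -> (forall i, x i 0 != 0) -> M *m x = a *: x ->
  exists q : {poly F}, char_poly M = ('X - a%:P) * q /\
    forall b, root q b ->
      exists w : 'rV[F]_n, [/\ w != 0, w *m M = b *: w & w *m x = 0].
Proof.
case: n M x => // m; rewrite -[m.+1]/(1 + m)%N => M x _ /(_ 0) x00 Mx.
pose P : 'M[F]_(1 + m) := row_mx x (col_mx 0 1%:M).
have PE : P = block_mx (usubmx x) 0 (dsubmx x) 1%:M.
  by rewrite block_mxEh vsubmxK.
have detP : \det P != 0.
  rewrite PE det_lblock det1 mulr1 det_mx11 mxE.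
  by rewrite (_ : lshift m 0 = 0) //; apply: val_inj.
have Pu : P \in unitmx by rewrite unitmxE unitfE.
pose K := invmx P *m M *m P.
have MP : M *m P = P *m K by rewrite /K !mulmxA mulmxV // mul1mx.
have Px : P *m (col_mx 1%:M 0) = x by rewrite mul_row_col mulmx1 mulmx0 addr0.
have Kx : K *m col_mx 1%:M 0 = col_mx (a%:M) 0.
  rewrite /K -!mulmxA Px Mx -Px -scalemxAr mulKmx //.
  by rewrite scale_col_mx scaler0 scalemx1.
have KE : K = block_mx a%:M (ursubmx K) 0 (drsubmx K).
  rewrite -[LHS]submxK; move: Kx.
  rewrite -{1}[K]submxK mul_block_col !mulmx1 !mulmx0 !addr0.
  by case/eq_col_mx => -> ->.
exists (char_poly (drsubmx K)); split.
  have poly_unit : map_mx polyC P \in unitmx.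
    by rewrite unitmxE det_map_mx poly_unitE size_polyC detP coefC /= unitfE.
  have -> : char_poly M = char_poly K.
    have : char_poly_mx M *m map_mx polyC P = map_mx polyC P *m char_poly_mx K.
      rewrite mulmxBl mulmxBr -!map_mxM MP mul_scalar_mx mul_mx_scalar.
      by [].
    move/(congr1 (fun Q => invmx (map_mx polyC P) *m Q)).
    rewrite mulKmx // => /(congr1 determinant).
    rewrite !det_mulmx mulrA mulrAC -det_mulmx mulVmx // det1 mul1r.
    by rewrite /char_poly => ->.
  rewrite /char_poly {1}KE /char_poly_mx map_block_mx scalar_mx_block.
  rewrite opp_block_mx add_block_mx map_mx0 subr0 det_ublock.
  by rewrite map_scalar_mx -raddfB /= det_scalar1.
move=> b; rewrite -eigenvalue_root_char => /eigenvalueP[u uK uN].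
exists (row_mx 0 u *m invmx P).
have rowN : row_mx (0 : 'rV[F]_1) u != 0.
  by apply: contra uN => /eqP; rewrite -row_mx0 => /eq_row_mx[_ ->].
split.
- apply: contra rowN => /eqP/(congr1 (mulmx^~ P)).
  by rewrite /= mulmxKV // mul0mx => ->.
- apply: (can_inj (mulmxK Pu)).
  rewrite /= -[_ *m M *m P]mulmxA MP mulmxA -scalemxAl !mulmxKV // {1}KE.
  rewrite mul_row_block.
  by rewrite !mul0mx !mulmx0 !add0r uK scale_row_mx scaler0.
- by rewrite -Px mulmxA mulmxKV // mul_row_col mul0mx mulmx0 addr0.
Qed.

Lemma sign_diag_involutive (R : pzRingType) (n : nat) (sigma : 'cV[R]_n) :
  (forall i, sigma i 0 = 1 \/ sigma i 0 = -1) ->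
  diag_mx sigma^T *m diag_mx sigma^T = 1%:M.
Proof.
move=> sig; apply/matrixP => i j; rewrite mul_diag_mx !mxE.
case: eqP => [->|]; last by rewrite mulr0.
by case: (sig j) => ->; rewrite ?mulrNN mulr1.
Qed.

(** The spectrum of A is read off the Perron pair of the positive matrix
D A^-1 D, with D the diagonal matrix of signs. A second eigenvalue as small as
lam, or a repeated one, would give a left eigenvector annihilating x. *)
Theorem signed_inverse_spectrum (R : realType) (n : nat) (A B : 'M[R]_n)
    (sigma : 'cV[R]_n) :
  (0 < n)%N -> (forall i, sigma i 0 = 1 \/ sigma i 0 = -1) ->
  A *m B = 1%:M -> (forall i j, 0 < sigma i 0 * B i j * sigma j 0) ->
  exists (lam : R) (x : 'cV[R]_n),
    [/\ 0 < lam /\ eigenvalue (complexify A) lam%:C,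
        mup lam%:C (char_poly (complexify A)) = 1%N,
        (forall mu : R[i], eigenvalue (complexify A) mu -> mu != lam%:C ->
           lam%:C < `|mu|),
        A *m x = lam *: x
      & forall i : 'I_n, 0 < sigma i 0 * x i 0].
Proof.
move=> n0 sig AB Bpos; have DD := sign_diag_involutive sig.
set D := diag_mx _ in DD; pose G := D *m B *m D.
have Gpos i j : 0 < G i j.
  by rewrite /G /D mul_diag_mx mul_mx_diag !mxE.
have [rho [y [rho0 y0 Gy]]] := perron_exists n0 Gpos.
have BA : B *m A = 1%:M by apply: mulmx1C.
pose x := D *m y.
have Bx : B *m x = rho *: x.
  by rewrite /x scalemxAr -Gy /G !mulmxA DD mul1mx.
have Ax : A *m x = rho^-1 *: x.
  rewrite -[x in RHS]mul1mx -AB -mulmxA Bx -scalemxAr scalerA mulVf ?scale1r //.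
  by rewrite gt_eqF.
have sx i : 0 < sigma i 0 * x i 0.
  rewrite /x /D mul_diag_mx !mxE mulrA.
  by case: (sig i) => ->; rewrite ?mulrNN ?mulr1 mul1r.
have xN i : x i 0 != 0 by apply: contraTneq (sx i) => ->; rewrite mulr0 ltxx.
pose toC := real_complex R.
have dom (mu : R[i]) (w : 'rV_n) : w != 0 -> w *m complexify A = mu *: w ->
    w *m map_mx toC x = 0 -> (rho^-1)%:C < `|mu|.
  move=> wN wA wx.
  have BAc : map_mx toC B *m complexify A = 1%:M by rewrite -map_mxM BA map_mx1.
  have ABc : complexify A *m map_mx toC B = 1%:M by rewrite -map_mxM AB map_mx1.
  have DDc : map_mx toC D *m map_mx toC D = 1%:M by rewrite -map_mxM DD map_mx1.
  have wE : w = mu *: (w *m map_mx toC B).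
    by rewrite scalemxAl -wA -mulmxA ABc mulmx1.
  have mu0 : mu != 0.
    by apply: contra wN => /eqP mu0; rewrite wE mu0 scale0r.
  have wB : w *m map_mx toC B = mu^-1 *: w.
    by rewrite [in RHS]wE scalerA mulVf // scale1r.
  have : `|mu^-1| < toC rho.
    apply: (@eigenvalue_dominated _ _ (map_mx toC G) (map_mx toC y)
      (w *m map_mx toC D)).
    - by move=> i j; rewrite mxE ltcR.
    - by move=> i; rewrite mxE ltcR.
    - by rewrite -map_mxM Gy map_mxZ.
    - apply: contra wN => /eqP wD.
      by rewrite -[w]mulmx1 -DDc mulmxA wD mul0mx.
    - rewrite /G !map_mxM !mulmxA -[w *m _ *m _]mulmxA DDc mulmx1 wB.
      by rewrite scalemxAl.
    - by rewrite -mulmxA -map_mxM.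
  rewrite normfV => lt_rho; rewrite fmorphV /= invf_plt ?posrE ?normr_gt0 //.
  by rewrite ltcR.
have Axc : complexify A *m map_mx toC x = (rho^-1)%:C *: map_mx toC x.
  by rewrite -map_mxM Ax map_mxZ.
have xcN i : map_mx toC x i 0 != 0 by rewrite mxE fmorph_eq0.
have [q [charA lift]] := char_poly_deflate n0 xcN Axc.
have qN : ~~ root q (rho^-1)%:C.
  apply/negP => /lift[w [wN wA wx]]; have := dom _ _ wN wA wx.
  by rewrite ger0_norm ?ltxx // lecR invr_ge0 ltW.
exists rho^-1, x; split=> //.
- rewrite invr_gt0; split=> //.
  by rewrite eigenvalue_root_char charA rootM root_XsubC eqxx.
- rewrite charA mupMl // -[X in mup _ X]expr1 mup_XsubCX eqxx //.
- move=> mu /eigenvalueP[w wA wN] mu_lam; apply: (dom _ w) => //.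
  have /eqP : w *m complexify A *m map_mx toC x = mu *: (w *m map_mx toC x).
    by rewrite wA scalemxAl.
  rewrite -mulmxA Axc -scalemxAr -subr_eq0 -scalerBl scaler_eq0 subr_eq0.
  by rewrite eq_sym (negbTE mu_lam) => /eqP.
Qed.

(** * Principal submatrices and their inverses *)

(** Padding by the identity lets principal submatrices of all sizes, and their
inverses, live in one type. *)
Definition restr (R : pzRingType) (n : nat) (M : 'M[R]_n) (S : {set 'I_n}) :
    'M[R]_n :=
  \matrix_(i, j) if (i \in S) && (j \in S) then M i j else (i == j)%:R.

Lemma trmx_restr (R : pzRingType) (n : nat) (M : 'M[R]_n) (S : {set 'I_n}) :
  (restr M S)^T = restr M^T S.
Proof. by apply/matrixP => i j; rewrite !mxE andbC eq_sym. Qed.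

Lemma cofactor_restr (R : comPzRingType) (n : nat) (M : 'M[R]_n)
    (S : {set 'I_n}) (p : 'I_n) :
  cofactor (restr M S) p p =
  \det (restr (row' p (col' p M)) (lift p @^-1: S)).
Proof.
rewrite /cofactor -signr_odd oddD addbb mul1r; congr (\det _).
by apply/matrixP => i j; rewrite !mxE !inE (inj_eq lift_inj).
Qed.

Lemma det_restr_notin (R : comPzRingType) (n : nat) (M : 'M[R]_n)
    (S : {set 'I_n}) (p : 'I_n) :
  p \notin S -> \det (restr M S) = cofactor (restr M S) p p.
Proof.
move=> pS; rewrite (expand_det_row _ p) (bigD1 p) //= mxE (negbTE pS) eqxx.
rewrite mul1r big1 ?addr0 // => j jp.
by rewrite mxE (negbTE pS) eq_sym (negbTE jp) mul0r.
Qed.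

Lemma det_restr_setD1 (R : comPzRingType) (n : nat) (M : 'M[R]_n)
    (S : {set 'I_n}) (p : 'I_n) :
  \det (restr M (S :\ p)) = cofactor (restr M S) p p.
Proof.
rewrite (@det_restr_notin _ _ _ _ p) ?setD11 // !cofactor_restr.
congr (\det (restr _ _)); apply/setP => i.
by rewrite !inE eq_sym neq_lift.
Qed.

(** A vertex outside S can be deleted without changing the padded determinant;
once none is left, the determinant is that of the whole matrix. *)
Lemma P_matrix_restr (R : realType) (n : nat) (M : 'M[R]_n) (S : {set 'I_n}) :
  P_matrix M -> 0 < \det (restr M S).
Proof.
elim: n M S => [|n IHn] M S PM; first by rewrite det_mx00 ltr01.
have [-> | ] := eqVneq S setT.
  have -> : restr M setT = mxsub id id M.
    by apply/matrixP => i j; rewrite !mxE !inE.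
  exact: PM.
rewrite -subTset => /subsetPn[p _ pS].
rewrite (det_restr_notin _ pS) cofactor_restr; apply: IHn => k f fincr.
have -> : mxsub f f (row' p (col' p M)) = mxsub (lift p \o f) (lift p \o f) M.
  by apply/matrixP => i j; rewrite !mxE.
apply: PM => i j ij /=.
have := fincr i j ij; rewrite /bump => fij; case: leqP; case: leqP => //; lia.
Qed.

Lemma invmx_restr_diag (R : realFieldType) (n : nat) (M : 'M[R]_n)
    (S : {set 'I_n}) (p : 'I_n) :
  0 < \det (restr M S) -> 0 < \det (restr M (S :\ p)) ->
  0 < invmx (restr M S) p p.
Proof.
move=> S0 Sp0; have U : restr M S \in unitmx by rewrite unitmxE unitfE gt_eqF.
by rewrite /invmx U !mxE -det_restr_setD1 mulr_gt0 // invr_gt0.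
Qed.

(** The entries of M *m v outside S do not matter when v is supported in S.
In this form, relations between inverses on different sets S reduce to
comparing right-hand sides. *)
Lemma restr_solve (R : comUnitRingType) (n : nat) (M : 'M[R]_n)
    (S : {set 'I_n}) (v : 'cV[R]_n) (i : 'I_n) :
  restr M S \in unitmx -> (forall k, k \notin S -> v k 0 = 0) ->
  v i 0 = \sum_(j in S) invmx (restr M S) i j * (M *m v) j 0.
Proof.
move=> U vS; rewrite -[v in LHS](mulKmx U) mxE [RHS]big_mkcond /=.
apply: eq_bigr => j _; case: ifP => jS; last first.
  rewrite !mxE big1 ?mulr0 // => k _; rewrite mxE jS /=.
  by case: eqP => [<-|]; rewrite ?mul0r // vS ?jS ?mulr0.
congr (_ * _); rewrite !mxE; apply: eq_bigr => k _; rewrite !mxE jS /=.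
by case: ifPn => // kS; rewrite vS ?mulr0.
Qed.

Lemma invmx_restr_supp (R : comUnitRingType) (n : nat) (M : 'M[R]_n)
    (S : {set 'I_n}) (r k : 'I_n) :
  restr M S \in unitmx -> r \in S -> k \notin S -> invmx (restr M S) k r = 0.
Proof.
move=> U rS kS; have /matrixP/(_ k r) := mulmxV U; rewrite !mxE.
rewrite (bigD1 k) //= big1 ?addr0 => [|j jk].
  rewrite mxE (negbTE kS) eqxx mul1r => ->.
  by case: eqP => // kr; rewrite kr rS in kS.
by rewrite mxE (negbTE kS) eq_sym (negbTE jk) mul0r.
Qed.

Lemma invmx_restr_col (R : comUnitRingType) (n : nat) (M : 'M[R]_n)
    (S : {set 'I_n}) (r i : 'I_n) :
  restr M S \in unitmx -> r \in S -> i \in S ->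
  (M *m col r (invmx (restr M S))) i 0 = (i == r)%:R.
Proof.
move=> U rS iS; have /matrixP/(_ i r) := mulmxV U; rewrite !mxE => <-.
apply: eq_bigr => k _; rewrite !mxE iS /=.
by case: ifPn => // kS; rewrite invmx_restr_supp ?mulr0.
Qed.

Definition inverse_positive (R : realFieldType) (n : nat) (M : 'M[R]_n)
    (S : {set 'I_n}) : Prop :=
  forall i j, i \in S -> j \in S -> 0 < invmx (restr M S) i j.

Lemma inverse_positive_tr (R : realFieldType) (n : nat) (M : 'M[R]_n)
    (S : {set 'I_n}) : inverse_positive M S -> inverse_positive M^T S.
Proof. by move=> pos i j iS jS; rewrite -trmx_restr -trmx_inv mxE pos. Qed.

(** The column of the inverse on S - q1 - q2, suitably scaled, is a lower bound
for column r of the inverse on S: the difference solves a system on S - r with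
nonnegative right-hand side. *)
Lemma inverse_positive_col (R : realFieldType) (n : nat) (M : 'M[R]_n)
    (S : {set 'I_n}) (q1 q2 r : 'I_n) :
  q1 \in S -> q2 \in S -> r \in S -> q1 != q2 -> q1 != r -> q2 != r ->
  0 < \det (restr M S) -> 0 < \det (restr M (S :\ r)) ->
  0 < \det (restr M (S :\ q1)) -> 0 < \det (restr M (S :\ q2)) ->
  0 < \det (restr M (S :\ q1 :\ q2)) ->
  inverse_positive M (S :\ r) ->
  inverse_positive M (S :\ q1) -> inverse_positive M (S :\ q2) ->
  inverse_positive M (S :\ q1 :\ q2) ->
  forall i, i \in S -> 0 < invmx (restr M S) i r.
Proof.
move=> q1S q2S rS q12 q1r q2r dS dr d1 d2 d12 posr pos1 pos2 pos12.
have unit_of X : 0 < \det (restr M X) -> restr M X \in unitmx.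
  by move=> dX; rewrite unitmxE unitfE gt_eqF.
move: (unit_of _ dS) (unit_of _ dr) (unit_of _ d1) (unit_of _ d2)
  (unit_of _ d12) => US Ur U1 U2 U12.
have r12 : r \in S :\ q1 :\ q2 by rewrite !inE ![r == _]eq_sym q1r q2r.
pose w := col r (invmx (restr M (S :\ q1 :\ q2))).
have w0 k : k \notin S :\ q1 :\ q2 -> w k 0 = 0.
  by move=> kS; rewrite mxE invmx_restr_supp.
have wp k : k \in S :\ q1 :\ q2 -> 0 < w k 0 by move=> kS; rewrite mxE pos12.
have Mw k : k \in S :\ q1 :\ q2 -> (M *m w) k 0 = (k == r)%:R.
  exact: invmx_restr_col.
(* w vanishes at q, so solving on S minus the other leaf forces the q-entry of
   M w to be negative *)
have neg q q' : q \in S -> q' \in S -> q != q' -> q != r -> q' != r ->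
    S :\ q1 :\ q2 = S :\ q' :\ q -> restr M (S :\ q') \in unitmx ->
    inverse_positive M (S :\ q') -> (M *m w) q 0 < 0.
  move=> qS q'S qq' qr q'r SE U pos.
  have q_in : q \in S :\ q' by rewrite !inE qq'.
  have r_in : r \in S :\ q' by rewrite !inE eq_sym q'r.
  have wq : w q 0 = 0 by rewrite w0 // SE setD11.
  have := restr_solve (v := w) q U.
  rewrite wq (bigD1 q) //= (bigD1 r) /=; last by rewrite r_in eq_sym qr.
  rewrite big1 => [|k /andP[/andP[kS kq] kr]]; last first.
    rewrite Mw ?(negbTE kr) ?mulr0 // SE.
    by move: kS; rewrite !inE kq.
  rewrite (Mw r) // eqxx mulr1 addr0 => solve.
  have {}solve : 0 = invmx (restr M (S :\ q')) q q * (M *m w) q 0 +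
      invmx (restr M (S :\ q')) q r.
    by apply: solve => k kS; apply: w0; rewrite SE in_setD1 (negbTE kS) andbF.
  have qq0 := pos q q q_in q_in; have qr0 := pos q r q_in r_in.
  rewrite -(pmulr_rlt0 _ qq0); move: solve qr0; lra.
have b1 : (M *m w) q1 0 < 0.
  by apply: (neg q1 q2) => //; rewrite setDDl setUC -setDDl.
have b2 : (M *m w) q2 0 < 0 by apply: (neg q2 q1) => //; rewrite eq_sym.
pose b := col r (invmx (restr M S)).
have br : 0 < b r 0 by rewrite mxE invmx_restr_diag.
have Mb k : k \in S -> (M *m b) k 0 = (k == r)%:R by exact: invmx_restr_col.
pose t := w r 0 / b r 0.
have t0 : 0 < t by rewrite divr_gt0 // wp.
pose v := t *: b - w.
have vE k : v k 0 = t * b k 0 - w k 0.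
  by rewrite mxE [X in X + _]mxE [X in _ + X]mxE.
have v0 k : k \notin S :\ r -> v k 0 = 0.
  rewrite !inE negb_and negbK => /orP[/eqP -> | kS].
    by rewrite vE /t divfK ?subrr // gt_eqF.
  rewrite vE w0 ?inE ?(negbTE kS) ?andbF //.
  by rewrite [b k 0]mxE invmx_restr_supp // mulr0 subr0.
have Mv k : k \in S :\ r -> (M *m v) k 0 = - (M *m w) k 0.
  rewrite !inE => /andP[kr kS].
  rewrite mulmxBr -scalemxAr mxE [X in X + _]mxE Mb // (negbTE kr) mulr0 add0r.
  by rewrite mxE.
have vp k : k \in S :\ r -> 0 < v k 0.
  move=> kS; rewrite (restr_solve _ Ur v0).
  have pos j : j \in S :\ r -> 0 <= invmx (restr M (S :\ r)) k j * (M *m v) j 0.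
    move=> jS; rewrite mulr_ge0 ?(ltW (posr _ _ _ _)) // Mv // oppr_ge0.
    have [-> | j1] := eqVneq j q1; first exact: ltW.
    have [-> | j2] := eqVneq j q2; first exact: ltW.
    move: jS; rewrite !inE => /andP[jr jS].
    by rewrite Mw ?(negbTE jr) // !inE j1 j2.
  have q1_in : q1 \in S :\ r by rewrite !inE q1r.
  rewrite (bigD1 q1) //= ltr_wpDr ?sumr_ge0 // => [j /andP[jS _]|].
    exact: pos.
  by rewrite mulr_gt0 ?posr // Mv // oppr_gt0.
move=> i iS; have [-> | ir] := eqVneq i r; first by move: br; rewrite mxE.
have : 0 < v i 0 by apply: vp; rewrite !inE ir.
rewrite vE [b i 0]mxE subr_gt0 => wtb; rewrite -(pmulr_rgt0 _ t0).
 apply: le_lt_trans wtb.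
by have [/wp/ltW | /w0 ->] := boolP (i \in S :\ q1 :\ q2).
Qed.

(** With C the inverse on S, the inverse on S - r has the entries
C i j - C i r * C r j / C r r, which are positive; so C i j is positive once
column r and row r are. *)
Lemma inverse_positive_step (R : realFieldType) (n : nat) (M : 'M[R]_n)
    (S : {set 'I_n}) (q1 q2 r : 'I_n) :
  q1 \in S -> q2 \in S -> r \in S -> q1 != q2 -> q1 != r -> q2 != r ->
  0 < \det (restr M S) -> 0 < \det (restr M (S :\ r)) ->
  0 < \det (restr M (S :\ q1)) -> 0 < \det (restr M (S :\ q2)) ->
  0 < \det (restr M (S :\ q1 :\ q2)) ->
  inverse_positive M (S :\ r) ->
  inverse_positive M (S :\ q1) -> inverse_positive M (S :\ q2) ->
  inverse_positive M (S :\ q1 :\ q2) ->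
  inverse_positive M S.
Proof.
move=> q1S q2S rS q12 q1r q2r dS dr d1 d2 d12 posr pos1 pos2 pos12.
have det_trmx_restr X : \det (restr M^T X) = \det (restr M X).
  by rewrite -trmx_restr det_tr.
have colr := inverse_positive_col q1S q2S rS q12 q1r q2r dS dr d1 d2 d12
  posr pos1 pos2 pos12.
have rowr j : j \in S -> 0 < invmx (restr M S) r j.
  move=> jS; have := @inverse_positive_col _ _ M^T S q1 q2 r.
  rewrite !det_trmx_restr => /(_ q1S q2S rS q12 q1r q2r dS dr d1 d2 d12).
  have tr X := @inverse_positive_tr _ _ M X.
  move=> /(_ (tr _ posr) (tr _ pos1) (tr _ pos2) (tr _ pos12) j jS).
  by rewrite -trmx_restr -trmx_inv mxE.
have US : restr M S \in unitmx by rewrite unitmxE unitfE gt_eqF.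
have Ur : restr M (S :\ r) \in unitmx by rewrite unitmxE unitfE gt_eqF.
set C := invmx (restr M S) in colr rowr *.
move=> i j iS jS; have [-> | ir] := eqVneq i r; first exact: rowr.
have [-> | jr] := eqVneq j r; first exact: colr.
have i_in : i \in S :\ r by rewrite !inE ir.
have j_in : j \in S :\ r by rewrite !inE jr.
pose c := C r j / C r r.
have c0 : 0 < c by rewrite divr_gt0 // rowr.
pose v := col j C - c *: col r C.
have vE k : v k 0 = C k j - c * C k r by rewrite !mxE.
have v0 k : k \notin S :\ r -> v k 0 = 0.
  rewrite vE !inE negb_and negbK => /orP[/eqP -> | kS].
    by rewrite /c divfK ?subrr // gt_eqF // rowr.
  by rewrite /C !invmx_restr_supp // mulr0 subr0.
have Mv k : k \in S :\ r -> (M *m v) k 0 = (k == j)%:R.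
  rewrite !inE => /andP[kr kS].
  rewrite mulmxBr -scalemxAr mxE [X in _ + X]mxE [X in _ - X]mxE.
  by rewrite !invmx_restr_col // (negbTE kr) mulr0 subr0.
have : 0 < v i 0.
  rewrite (restr_solve _ Ur v0) (bigD1 j) //= Mv // eqxx mulr1.
  rewrite big1 ?addr0 ?posr //.
  by move=> k /andP[kS kj]; rewrite Mv // (negbTE kj) mulr0.
rewrite vE subr_gt0; apply: le_lt_trans.
by rewrite mulr_ge0 ?ltW // colr.
Qed.

(** * Subtrees *)

(** Nonempty connected vertex sets of a tree, given by an order of
construction in which each new vertex has a single neighbour among the earlier
ones. This makes acyclicity available to induction. *)
Inductive subtree (T : finType) (e : rel T) : {set T} -> Prop :=
| subtree_vertex v : subtree e [set v]
| subtree_attach S u v : subtree e S -> u \in S -> v \notin S -> e u v ->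
    (forall w, w \in S -> e w v -> w = u) -> subtree e (v |: S).

Definition leaf (T : finType) (e : rel T) (S : {set T}) (v : T) : Prop :=
  v \in S /\
  exists u, [/\ u \in S, e v u & forall w, w \in S -> e v w -> w = u].

Lemma subtree_isolated (T : finType) (e : rel T) (S : {set T}) (x : T) :
  symmetric e -> subtree e S -> x \in S ->
  (forall w, w \in S -> e x w = false) -> S = [set x].
Proof.
move=> sym tS; elim: tS x => {S} [v | S u v _ IH uS vS uv _] x.
  by rewrite inE => /eqP ->.
rewrite !inE => /orP[/eqP -> iso | xS iso].
  by have := iso u; rewrite !inE uS orbT sym uv => /(_ isT).
have S1 : S = [set x] by apply: IH => // w wS; apply: iso; rewrite !inE wS orbT.
have := iso v; rewrite !inE eqxx => /(_ isT).
by move: uS; rewrite S1 inE => /eqP <-; rewrite uv.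
Qed.

(** The removed leaf need not be the vertex attached last. It commutes with the
last attachment unless the two are adjacent, and then they are all of S. *)
Lemma subtree_setD1 (T : finType) (e : rel T) (S : {set T}) (x : T) :
  symmetric e -> irreflexive e -> subtree e S -> leaf e S x ->
  subtree e (S :\ x).
Proof.
move=> sym irr tS; elim: tS x => {S} [v | S u v tS IH uS vS uv uniq_u] x.
  case=> [/set1P-> [y [/set1P-> ]]]; by rewrite irr.
case=> [xvS [y [yvS xy uniq_y]]].
have [xv | xv] := eqVneq x v; first by rewrite xv setU1K.
have xS : x \in S by move: xvS; rewrite !inE (negbTE xv).
have [yv | yv] := eqVneq y v.
  have -> : S = [set x].
    apply: (subtree_isolated sym tS xS) => w wS; apply/negP => xw.
    have wy : w = y by apply: uniq_y; rewrite // !inE wS orbT.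
    by rewrite -yv -wy wS in vS.
  by rewrite setUC setU1K; [apply: subtree_vertex | rewrite inE].
have yS : y \in S by move: yvS; rewrite !inE (negbTE yv).
have xu : x != u.
  apply: contra yv => /eqP xu; rewrite (uniq_y v) ?eqxx // ?xu //.
  by rewrite !inE eqxx.
have -> : (v |: S) :\ x = v |: (S :\ x).
  apply/setP => z; rewrite !inE; case: (eqVneq z v) => [->|//].
  by rewrite eq_sym xv.
apply: (@subtree_attach _ _ _ u) => //.
- apply: IH; split=> //; exists y; split=> // w wS; apply: uniq_y.
  by rewrite !inE wS orbT.
- by rewrite !inE eq_sym xu.
- by rewrite !inE (negbTE vS) andbF.
- by move=> w; rewrite !inE => /andP[_]; apply: uniq_u.
Qed.

(** Two adjacent leaves make up the whole subtree, so a third vertex keeps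
them apart. *)
Lemma leaf_setD1 (T : finType) (e : rel T) (S : {set T}) (x y z : T) :
  symmetric e -> irreflexive e -> subtree e S -> leaf e S x -> leaf e S y ->
  y != x -> z \in S -> z != x -> z != y -> leaf e (S :\ x) y.
Proof.
move=> sym irr tS lx ly yx zS zx zy.
have yS : y \in S :\ x by case: ly => yS _; rewrite !inE yx.
split=> //; have [_ [u [uS yu uniq_u]]] := ly.
exists u; split=> // [|w]; last by rewrite !inE => /andP[_]; apply: uniq_u.
rewrite !inE uS andbT; apply/eqP => ux.
have /setP/(_ z) : S :\ x = [set y].
  apply: (subtree_isolated sym (subtree_setD1 sym irr tS lx) yS) => w.
  rewrite !inE => /andP[wx wS]; apply/negP => yw.
  by rewrite (uniq_u w wS yw) ux eqxx in wx.
by rewrite !inE zx zS (negbTE zy).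
Qed.

Lemma leaf_attached (T : finType) (e : rel T) (S : {set T}) (u v : T) :
  symmetric e -> irreflexive e -> u \in S -> e u v ->
  (forall w, w \in S -> e w v -> w = u) -> leaf e (v |: S) v.
Proof.
move=> sym irr uS uv uniq_u; split; first by rewrite !inE eqxx.
exists u; rewrite sym uv !inE uS orbT; split=> // w.
by rewrite !inE => /orP[/eqP -> | wS]; rewrite ?irr // sym; apply: uniq_u.
Qed.

Lemma leaf_setU1 (T : finType) (e : rel T) (S : {set T}) (u v x : T) :
  (forall w, w \in S -> e w v -> w = u) -> x != u -> leaf e S x ->
  leaf e (v |: S) x.
Proof.
move=> uniq_u xu [xS [y [yS xy uniq_y]]]; split; first by rewrite !inE xS orbT.
exists y; split=> // [|w]; first by rewrite !inE yS orbT.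
rewrite !inE => /orP[/eqP -> xv | ]; last exact: uniq_y.
by rewrite (uniq_u x xS xv) eqxx in xu.
Qed.

(** A new vertex prolongs a path when attached to an end of it and is a third
leaf otherwise; attached to one of three leaves, it replaces that leaf. *)
Lemma subtree_path_or_leaves (T : finType) (e : rel T) (S : {set T}) :
  symmetric e -> irreflexive e -> subtree e S ->
  [\/ exists v, S = [set v],
      exists x s, [/\ path e x s, uniq (x :: s), (0 < size s)%N,
        S = [set y in x :: s] & leaf e S x /\ leaf e S (last x s)]
    | exists a b c, [/\ a != b, a != c, b != c
        & [/\ leaf e S a, leaf e S b & leaf e S c]]].
Proof.
move=> sym irr; elim=> {S} [v | S u v tS IH uS vS uv uniq_u].
  by constructor 1; exists v.
have lv := leaf_attached sym irr uS uv uniq_u.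
have lW := leaf_setU1 uniq_u.
have vN x : leaf e S x -> v != x by case=> xS _; apply: contraNneq vS => ->.
case: IH => [[x Sx] | [x [s [ps us s0 Ss [lx ll]]]] |
             [a [b [c [ab ac bc [la lb lc]]]]]].
- move: uS; rewrite Sx inE => /eqP ux; subst x.
  constructor 2; exists v, [:: u]; rewrite /= sym uv inE.
  have vu : v != u by apply: contraNneq vS => ->; rewrite Sx set11.
  split=> //; first by rewrite vu.
    by apply/setP => y; rewrite !inE.
  rewrite -Sx; split=> //; split; first by rewrite Sx !inE eqxx orbT.
  exists v; split=> // [|w]; first by rewrite !inE eqxx.
  by rewrite Sx !inE => /orP[/eqP | /eqP ->] //; rewrite irr.
- have xl : x != last x s.
    case: s s0 us {ps Ss ll} => // a s _ /= /andP[xs _].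
    by apply: contraNneq xs => ->; rewrite mem_last.
  have vxs : v \notin x :: s by move: vS; rewrite Ss inE.
  have [ux | ux] := eqVneq u x.
    constructor 2; exists v, (x :: s); split=> //=.
    + by rewrite ps sym -ux uv.
    + by rewrite vxs; move: us => /= ->.
    + by apply/setP => y; rewrite Ss !inE.
    + by split=> //; apply: lW => //; rewrite ux eq_sym.
  have [ul | ul] := eqVneq u (last x s).
    constructor 2; exists x, (rcons s v); split=> //=.
    + by rewrite rcons_path ps -ul uv.
    + by rewrite -[_ && _]/(uniq (rcons (x :: s) v)) rcons_uniq vxs.
    + by rewrite size_rcons.
    + by apply/setP => y; rewrite Ss !inE mem_rcons inE orbCA.
    + by rewrite last_rcons; split=> //; apply: lW; rewrite // eq_sym.
  constructor 3; exists v, x, (last x s); rewrite !vN //; split=> //.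
  by split=> //; apply: lW; rewrite // eq_sym.
constructor 3; have [ua | ua] := eqVneq a u.
  exists v, b, c; rewrite !vN //; split=> //; split=> //; apply: lW => //.
    by rewrite -ua eq_sym.
  by rewrite -ua eq_sym.
have [ub | ub] := eqVneq b u.
  exists a, v, c; rewrite eq_sym !vN //; split=> //.
  split=> //; apply: lW => //.
  by rewrite -ub eq_sym.
have [uc | uc] := eqVneq c u.
  exists a, b, v; rewrite ![_ == v]eq_sym !vN //; split=> //.
  by split=> //; apply: lW.
by exists a, b, c; split=> //; split; apply: lW.
Qed.

Lemma subtree_colouring (T : finType) (e : rel T) (S : {set T}) :
  symmetric e -> irreflexive e -> subtree e S ->
  exists colour : T -> bool,
    forall i j, i \in S -> j \in S -> e i j -> colour i = ~~ colour j.
Proof.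
move=> sym irr; elim=> {S} [v | S u v tS [colour IH] uS vS uv uniq_u].
  by exists xpredT => i j; rewrite !inE => /eqP -> /eqP ->; rewrite irr.
exists (fun w => if w == v then ~~ colour u else colour w) => i j.
have nv w : w \in S -> (w == v) = false.
  by move=> wS; apply: contraNF vS => /eqP <-.
rewrite !inE => /orP[/eqP -> | iS] /orP[/eqP -> | jS];
  rewrite ?irr ?eqxx ?nv //.
- by rewrite sym => /(uniq_u j jS) ->.
- by move=> /(uniq_u i iS) ->; rewrite negbK.
- exact: IH.
Qed.

Lemma subtree_connect (T : finType) (e : rel T) (S : {set T}) :
  symmetric e -> subtree e S -> forall x y, x \in S -> y \in S ->
  connect [rel a b | [&& e a b, a \in S & b \in S]] x y.
Proof.
move=> sym; elim=> {S} [v | S u v tS IH uS vS uv uniq_u] x y.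
  by rewrite !inE => /eqP -> /eqP ->; apply: connect0.
have inS x' y' : x' \in S -> y' \in S ->
    connect [rel a b | [&& e a b, a \in v |: S & b \in v |: S]] x' y'.
  move=> xS yS; apply: connect_sub (IH _ _ xS yS) => a b /=.
  by case/and3P=> ab aS bS; apply: connect1; rewrite /= ab !inE aS bS !orbT.
have vu : connect [rel a b | [&& e a b, a \in v |: S & b \in v |: S]] v u.
  by apply: connect1; rewrite /= sym uv !inE eqxx uS orbT.
have uv' : connect [rel a b | [&& e a b, a \in v |: S & b \in v |: S]] u v.
  by apply: connect1; rewrite /= uv !inE eqxx uS orbT.
rewrite !inE => /orP[/eqP -> | xS] /orP[/eqP -> | yS].
- exact: connect0.
- exact: connect_trans vu (inS _ _ uS yS).
- exact: connect_trans (inS _ _ xS uS) uv'.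
- exact: inS.
Qed.

Lemma connect_boundary (T : finType) (e : rel T) (S : {set T}) (x y : T) :
  connect e x y -> x \in S -> y \notin S ->
  exists u v, [/\ u \in S, v \notin S & e u v].
Proof.
case/connectP=> p; elim: p x => [|z p IH] x /=; first by move=> _ -> ->.
case/andP=> xz pz yE xS yS; have [zS | zS] := boolP (z \in S).
  exact: IH pz yE zS yS.
by exists x, z.
Qed.

(** The whole tree is reached by attaching vertices one at a time: two
neighbours of a new vertex would close a cycle through the part already
built. *)
Lemma tree_subtree (n : nat) (e : rel 'I_n) : is_tree e -> subtree e setT.
Proof.
case=> n0 sym irr con acyc.
have grow k : (k < n)%N -> exists S, subtree e S /\ #|S| = k.+1.
  elim: k => [_ | k IH kn].
    exists [set Ordinal n0]; rewrite cards1; split=> //; exact: subtree_vertex.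
  have [S [tS cS]] := IH (ltnW kn).
  have [x xS] : exists x, x \in S by apply/set0Pn; rewrite -card_gt0 cS.
  have [y yS] : exists y, y \notin S.
    have : [exists y, y \notin S].
      rewrite -negb_forall; apply/negP => /forallP all_S.
      have : S = setT by apply/setP => z; rewrite inE all_S.
      by move=> ST; move: cS kn; rewrite ST cardsT card_ord => ->; rewrite ltnn.
    by case/existsP=> y yS; exists y.
  have [u [v [uS vS uv]]] := connect_boundary (con x y) xS yS.
  exists (v |: S); rewrite cardsU1 vS cS; split=> //.
  apply: (subtree_attach tS uS vS uv) => w wS wv.
  apply/eqP; apply/negPn/negP => wu.
  have /connectP[p pp wE] := subtree_connect sym tS uS wS.
  move: wE wu; case/shortenP: pp => {p} p pp up _ wE wu.
  apply: (acyc (v :: u :: p)).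
    by case: p wE {pp up} wu => //= -> ; rewrite eqxx.
  have pS z : z \in u :: p -> z \in S.
    rewrite inE => /orP[/eqP -> //|].
    elim: p u {up wE wu uS uv} pp => //= a p IHp u.
    case/andP=> /and3P[_ _ aS] pp; rewrite inE => /orP[/eqP -> //|].
    exact: IHp pp.
  rewrite /ucycle /= sym uv rcons_path -wE wv andbT.
  rewrite (sub_path _ pp) => [|a b /and3P[]//]; move: up => /= ->.
  by rewrite andbT; apply: contra vS; apply: pS.
have [S [tS cS]] := grow n.-1 ltac:(by rewrite prednK).
have ST : S = setT.
  by apply/eqP; rewrite eqEcard subsetT cardsT card_ord cS prednK ?leqnn.
by rewrite -ST.
Qed.

(** * Paths *)

(** As long as the end of the path is not pendent, it has a neighbour other
than its predecessor, and this neighbour is new because a tree has no cycle. *)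
Lemma path_extend_end (n : nat) (e : rel 'I_n) (x : 'I_n) (s : seq 'I_n) :
  is_tree e -> path e x s -> uniq (x :: s) -> (0 < size s)%N ->
  exists t, [/\ path e x (s ++ t), uniq (x :: s ++ t)
    & pendent e (last x (s ++ t))].
Proof.
case=> n0 sym irr con acyc; move: {2}(n - size s)%N (leqnn (n - size s)) => k.
elim: k s => [|k IH] s sk ps us s0.
  have := max_card (mem (x :: s)); rewrite (card_uniqP us) card_ord /=.
  by move: sk; lia.
have [pen | npen] := eqVneq #|[set q | e (last x s) q]| 1%N.
  by exists [::]; rewrite cats0.
case/lastP: s s0 sk ps us npen => // s y _ sk ps us; rewrite last_rcons => npen.
have [ps' zy] : path e x s /\ e (last x s) y.
  by move: ps; rewrite rcons_path => /andP[].
have [w wy wz] : exists2 w, e y w & w != last x s.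
  have zN : last x s \in [set q | e y q] by rewrite inE sym.
  have : [set q | e y q] :\ last x s != set0.
    by apply: contra npen => /eqP N0; rewrite (cardsD1 (last x s)) zN N0 cards0.
  by case/set0Pn=> w; rewrite !inE => /andP[wz yw]; exists w.
have [w_in | w_out] := boolP (w \in x :: rcons s y).
  exfalso; move: w_in; rewrite inE mem_rcons inE.
  case/or3P => [/eqP wx | /eqP wyE | w_s]; last 1 first.
  - move: wz ps us zy; case/path.splitP: w_s => p1 p2 wz ps us zy.
    apply: (acyc (w :: rcons p2 y)).
      rewrite /= size_rcons; case: p2 wz {ps us zy} => //.
      by rewrite cats0 last_rcons eqxx.
    rewrite /ucycle /= rcons_path last_rcons wy andbT.
    move: ps; rewrite rcons_cat cat_path last_rcons => /andP[_ ->].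
    move: us; rewrite -cats1 /= -catA cat_rcons cat_uniq => /and4P[_ _ _].
    by rewrite cats1.
  - subst w; apply: (acyc (x :: rcons s y)).
      by rewrite /= size_rcons; case: (s) wz => //=; rewrite eqxx.
    by rewrite /ucycle us andbT /= rcons_path ps last_rcons.
  - by rewrite wyE irr in wy.
have [||||t [pt ut pent]] := IH (rcons (rcons s y) w).
- by move: sk; rewrite !size_rcons; lia.
- by rewrite rcons_path ps last_rcons.
- by rewrite -rcons_cons rcons_uniq w_out.
- by rewrite size_rcons.
by exists (w :: t); rewrite -cat_rcons.
Qed.

Lemma path_extend_start (n : nat) (e : rel 'I_n) (x : 'I_n) (s : seq 'I_n) :
  is_tree e -> path e x s -> uniq (x :: s) -> (0 < size s)%N ->
  exists p a, [/\ path e p (behead (a ++ x :: s)), uniq (a ++ x :: s),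
    p = head x (a ++ x :: s) & pendent e p].
Proof.
move=> tree ps us s0; have [_ sym _ _ _] := tree.
have revE : rev (x :: s) = last x s :: rev (belast x s).
  by rewrite lastI rev_rcons.
have ps' : path e (last x s) (rev (belast x s)).
  by rewrite rev_path; apply: sub_path ps => a b; rewrite sym.
have us' : uniq (last x s :: rev (belast x s)) by rewrite -revE rev_uniq.
have [|t [pt ut pent]] := path_extend_end tree ps' us'.
  by rewrite size_rev size_belast.
have lE : rev t ++ x :: s = rev (last x s :: rev (belast x s) ++ t).
  by rewrite -cat_cons -revE rev_cat revK.
have pE : last (last x s) (rev (belast x s) ++ t) = head x (rev t ++ x :: s).
  by rewrite lE lastI rev_rcons.
exists (head x (rev t ++ x :: s)), (rev t); rewrite -pE; split=> //.
  rewrite lE (lastI (last x s)) rev_rcons /= rev_path.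
  by apply: sub_path pt => a b; rewrite sym.
by rewrite lE rev_uniq.
Qed.

Lemma totally_positive_infix (R : realType) (n : nat) (A : 'M[R]_n)
    (a l b : seq 'I_n) :
  totally_positive (princ_sub A (a ++ l ++ b)) ->
  totally_positive (princ_sub A l).
Proof.
move=> TP k f g fincr gincr.
have lt_shift (i : 'I_(size l)) : (size a + i < size (a ++ l ++ b))%N.
  by rewrite !size_cat; have := ltn_ord i; lia.
pose shift i := Ordinal (lt_shift i).
have nth_shift i :
    tnth (in_tuple (a ++ l ++ b)) (shift i) = tnth (in_tuple l) i.
  have x0 := tnth (in_tuple l) i.
  by rewrite !(tnth_nth x0) /= nth_cat ltnNge leq_addr /= addKn nth_cat ltn_ord.
have -> : mxsub f g (princ_sub A l) =
    mxsub (shift \o f) (shift \o g) (princ_sub A (a ++ l ++ b)).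
  by apply/matrixP => i j; rewrite !mxE /= !nth_shift.
by apply: TP => i j ij /=; rewrite ltn_add2l; [apply: fincr | apply: gincr].
Qed.

Lemma path_totally_positive (R : realType) (n : nat) (e : rel 'I_n)
    (A : 'M[R]_n) (x : 'I_n) (s : seq 'I_n) :
  is_tree e -> T_TP e A -> path e x s -> uniq (x :: s) -> (0 < size s)%N ->
  totally_positive (princ_sub A (x :: s)).
Proof.
move=> tree TP ps us s0.
have [t [pt ut pent]] := path_extend_end tree ps us s0.
have st0 : (0 < size (s ++ t))%N by rewrite size_cat ltn_addr.
have [p [a [pa ua pE penp]]] := path_extend_start tree pt ut st0.
apply: (@totally_positive_infix _ _ _ a _ t); rewrite cat_cons.
have lE : a ++ x :: s ++ t = p :: behead (a ++ x :: s ++ t).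
  by rewrite pE; case: (a).
have lastE : last p (behead (a ++ x :: s ++ t)) = last x (s ++ t).
  have -> : last p (behead (a ++ x :: s ++ t)) = last p (a ++ x :: s ++ t).
    by rewrite {2}lE.
  by rewrite last_cat.
rewrite lE; apply: TP => //; rewrite -?lE // lastE //.
have x_ne y : y \in s ++ t -> y != x.
  by move: ut => /= /andP[xst _] yst; apply: contraNneq xst => <-.
have last_in : last x (s ++ t) \in s ++ t.
  by case: (s ++ t) st0 => //= y l _; rewrite mem_last.
rewrite pE; case: (a) ua => [_ | y a'] /=; first by rewrite eq_sym x_ne.
case/andP=> y_out _; apply: contraNneq y_out => ->.
by rewrite mem_cat inE last_in !orbT.
Qed.

(** The entries of the adjugate are minors with checkerboard signs. *)
Lemma totally_positive_invmx (R : realType) (m : nat) (P : 'M[R]_m)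
    (i j : 'I_m) :
  totally_positive P -> 0 < (-1) ^+ (i + j) * invmx P i j.
Proof.
move=> TP.
have detP : 0 < \det P.
  have -> : P = mxsub id id P by apply/matrixP => a b; rewrite mxE.
  exact: TP.
have U : P \in unitmx by rewrite unitmxE unitfE gt_eqF.
rewrite /invmx U !mxE mulrCA mulr_gt0 ?invr_gt0 // /cofactor addnC mulrA.
rewrite -signr_odd -expr2 sqrr_sign mul1r.
have -> : row' j (col' i P) = mxsub (lift j) (lift i) P.
  by apply/matrixP => a b; rewrite !mxE.
by apply: TP => a b ab /=; rewrite /bump; case: leqP; case: leqP => //; lia.
Qed.

(** * The signed inverse *)

Definition sign_conj (R : pzRingType) (n : nat) (sigma : 'cV[R]_n)
    (A : 'M[R]_n) : 'M[R]_n := \matrix_(i, j) (sigma i 0 * A i j * sigma j 0).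

Lemma sign_conjE (R : pzRingType) (n : nat) (sigma : 'cV[R]_n) (A : 'M[R]_n) :
  sign_conj sigma A = diag_mx sigma^T *m A *m diag_mx sigma^T.
Proof. by apply/matrixP => i j; rewrite mul_mx_diag mul_diag_mx !mxE. Qed.

Lemma det_restr_sign_conj (R : comPzRingType) (n : nat) (sigma : 'cV[R]_n)
    (A : 'M[R]_n) (S : {set 'I_n}) :
  (forall i, sigma i 0 = 1 \/ sigma i 0 = -1) ->
  \det (restr (sign_conj sigma A) S) = \det (restr A S).
Proof.
move=> sig; have -> : restr (sign_conj sigma A) S = sign_conj sigma (restr A S).
  apply/matrixP => i j; rewrite !mxE; case: ifP => // _.
  case: eqP => [<-|_]; last by rewrite mulr0 mul0r.
  by case: (sig i) => ->; rewrite mulr1 ?mulrNN mulr1.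
rewrite sign_conjE !det_mulmx mulrAC -det_mulmx.
by rewrite sign_diag_involutive // det1 mul1r.
Qed.

(** The signs alternate along the path, as those of the inverse of a totally
positive matrix do. That inverse, carried over from positions on the path to
vertices, solves the system that defines the padded inverse. *)
Lemma path_inverse_positive (R : realType) (n : nat) (e : rel 'I_n)
    (A : 'M[R]_n) (sigma : 'cV[R]_n) (x : 'I_n) (s : seq 'I_n) :
  signed_according e sigma -> path e x s -> uniq (x :: s) ->
  totally_positive (princ_sub A (x :: s)) ->
  0 < \det (restr A [set y in x :: s]) ->
  inverse_positive (sign_conj sigma A) [set y in x :: s].
Proof.
move=> [sig alt] ps us TP det0; set S := [set y in x :: s]; set l := x :: s.
pose v (a : 'I_(size l)) := tnth (in_tuple l) a.
have v_inj a b : (v a == v b) = (a == b).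
  by rewrite /v !(tnth_nth x) /= nth_uniq.
have sq i : sigma i 0 * sigma i 0 = 1.
  by case: (sig i) => ->; rewrite ?mulrNN mulr1.
have sv (a : 'I_(size l)) : sigma (v a) 0 = (-1) ^+ a * sigma x 0.
  rewrite /v (tnth_nth x) /=; case: a => /= a; elim: a => [|a IH] al.
    by rewrite expr0 mul1r.
  rewrite exprS -mulrA -IH ?(ltnW al) // mulN1r.
  have := pathP x ps a al => /alt ->.
  by rewrite opprK.
set M := sign_conj sigma A.
have U : restr M S \in unitmx.
  by rewrite unitmxE unitfE det_restr_sign_conj // gt_eqF.
have PU : princ_sub A l \in unitmx.
  rewrite unitmxE unitfE gt_eqF //.
  have -> : princ_sub A l = mxsub id id (princ_sub A l).
    by apply/matrixP => a b; rewrite [RHS]mxE.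
  exact: TP.
set Q := invmx (princ_sub A l).
have vS i : i \in S -> exists a, i = v a.
  by rewrite inE => il; have /tnthP := (il : i \in in_tuple l).
suff invE a b :
    invmx (restr M S) (v a) (v b) = sigma (v a) 0 * sigma (v b) 0 * Q a b.
  move=> i j /vS[a ->] /vS[b ->]; rewrite invE !sv mulrACA sq mulr1 -exprD.
  exact: totally_positive_invmx.
pose c := \col_k \sum_(a | k == v a) (sigma k 0 * sigma (v b) 0 * Q a b).
have cv a' : c (v a') 0 = sigma (v a') 0 * sigma (v b) 0 * Q a' b.
  rewrite mxE (bigD1 a') //= big1 ?addr0 // => k.
  by rewrite v_inj eq_sym => /andP[/eqP ->]; rewrite eqxx.
have c0 k : k \notin S -> c k 0 = 0.
  move=> kS; rewrite mxE big1 // => a' /eqP kE; case/negP: kS.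
  by rewrite kE inE; apply: mem_tnth.
have Mc a' : (M *m c) (v a') 0 = (a' == b)%:R.
  have -> : (M *m c) (v a') 0 = \sum_d M (v a') (v d) * c (v d) 0.
    rewrite mxE (bigID (fun k => k \in S)) /=.
    rewrite [X in _ + X]big1 ?addr0; last first.
      by move=> k kS; rewrite c0 ?mulr0.
    have -> : \sum_(k in S) M (v a') k * c k 0 =
        \sum_(k <- l) M (v a') k * c k 0.
      rewrite big_uniq //; apply: eq_bigl => k; by rewrite inE.
    by rewrite (big_tnth _ _ l).
  have /matrixP/(_ a' b) := mulmxV PU; rewrite !mxE => QE.
  transitivity (sigma (v a') 0 * sigma (v b) 0 * (a' == b)%:R); last first.
    by have [->|] := eqVneq a' b; rewrite ?mulr0 // sq mulr1.
  rewrite -QE mulr_sumr; apply: eq_bigr => d _; rewrite cv !mxE.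
  rewrite -/(v a') -/(v d) -/Q.
  have := sq (v d); move: (sigma (v d) 0) => t tt.
  by rewrite -[in RHS](mul1r (A _ _)) -tt; ring.
have vbS : v b \in S by rewrite inE; apply: mem_tnth.
have := restr_solve (v a) U c0.
rewrite cv (bigD1 (v b)) //= Mc eqxx mulr1 big1 ?addr0 // => k /andP[/vS[d ->]].
by rewrite v_inj Mc => /negbTE ->; rewrite mulr0.
Qed.

Lemma det_restr_subtree_gt0 (R : realType) (n : nat) (e : rel 'I_n)
    (A : 'M[R]_n) (S : {set 'I_n}) :
  (forall p, pendent e p -> P_matrix (delete_vertex A p)) -> 0 < \det A ->
  S = setT \/ (exists2 p, pendent e p & p \notin S) ->
  0 < \det (restr A S).
Proof.
move=> hP hdet [-> | [p pen pS]].
  suff -> : restr A setT = A by [].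
  by apply/matrixP => i j; rewrite !mxE !inE.
by rewrite (det_restr_notin _ pS) cofactor_restr; apply/P_matrix_restr/hP.
Qed.

Lemma pendent_leaf (n : nat) (e : rel 'I_n) (p : 'I_n) :
  leaf e setT p -> pendent e p.
Proof.
case=> _ [u [_ pu uniq_u]]; apply/eqP/cards1P; exists u; apply/setP => w.
rewrite !inE; apply/idP/eqP => [pw | -> //].
by apply: uniq_u; rewrite ?inE.
Qed.

(** The condition on S is inherited when a leaf is removed: a leaf of the whole
tree is pendent, so the first removal already leaves out a pendent vertex. *)
Theorem subtree_inverse_positive (R : realType) (n : nat) (e : rel 'I_n)
    (A : 'M[R]_n) (sigma : 'cV[R]_n) (S : {set 'I_n}) :
  is_tree e -> T_TP e A -> signed_according e sigma ->
  (forall p, pendent e p -> P_matrix (delete_vertex A p)) -> 0 < \det A ->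
  subtree e S -> S = setT \/ (exists2 p, pendent e p & p \notin S) ->
  inverse_positive (sign_conj sigma A) S.
Proof.
move=> tree TP sigT hP hdet; have [n0 sym irr _ _] := tree.
have [sig _] := sigT.
move: {2}#|S| (leqnn #|S|) => k; elim: k S => [|k IH] S Sk tS good.
  move: Sk; rewrite leqn0 cards_eq0 => /eqP -> i j; by rewrite inE.
have det_pos X : X = setT \/ (exists2 p, pendent e p & p \notin X) ->
    0 < \det (restr (sign_conj sigma A) X).
  move=> goodX; rewrite det_restr_sign_conj //.
  exact: (det_restr_subtree_gt0 hP hdet).
have dS := det_pos _ good.
have [[v Sv] | [x [s [ps us s0 SE _]]]
     | [q1 [q2 [r [q12 q1r q2r [l1 l2 lr]]]]]] :=
  subtree_path_or_leaves sym irr tS.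
- move=> i j; rewrite Sv !inE => /eqP -> /eqP ->.
  apply: invmx_restr_diag; first by rewrite -Sv.
  rewrite setDv.
  have -> : restr (sign_conj sigma A) set0 = 1%:M.
    by apply/matrixP => a b; rewrite !mxE !inE.
  by rewrite det1 ltr01.
- rewrite SE; apply: (@path_inverse_positive _ _ e) => //.
    exact: (path_totally_positive tree TP ps us s0).
  by rewrite -SE -(det_restr_sign_conj _ _ sig).
have in_S x : leaf e S x -> x \in S by case.
have goodD x : leaf e S x ->
    S :\ x = setT \/ (exists2 p, pendent e p & p \notin S :\ x).
  move=> lx; right; case: good lx => [-> lx | [p pen pS] _].
    by exists x; [apply: pendent_leaf | rewrite setD11].
  by exists p => //; rewrite inE (negbTE pS) andbF.
have goodDD : S :\ q1 :\ q2 = setT \/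
    (exists2 p, pendent e p & p \notin S :\ q1 :\ q2).
  have [S1 | [p pen pS]] := goodD q1 l1.
    have : q1 \in S :\ q1 by rewrite S1 inE.
    by rewrite setD11.
  by right; exists p => //; rewrite in_setD1 (negbTE pS) andbF.
have cardD (X : {set 'I_n}) x : (#|X :\ x| <= #|X|)%N.
  by rewrite subset_leq_card // subsetDl.
have cardS x : leaf e S x -> (#|S :\ x| <= k)%N.
  by move=> lx; move: Sk; rewrite (cardsD1 x) in_S // add1n ltnS.
have posD x (lx : leaf e S x) : inverse_positive (sign_conj sigma A) (S :\ x).
  by apply: IH; [apply: cardS | apply: subtree_setD1 | apply: goodD].
apply: (@inverse_positive_step _ _ _ _ q1 q2 r); rewrite ?in_S //;
  try by [apply: det_pos; apply: goodD | apply: posD].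
  exact: det_pos.
apply: IH => //; first exact: leq_trans (cardD _ _) (cardS _ l1).
apply: subtree_setD1 => //; first exact: subtree_setD1.
apply: (leaf_setD1 (z := r)) => //; rewrite ?in_S // 1?eq_sym //.
Qed.

Lemma tree_signing (R : realType) (n : nat) (e : rel 'I_n) :
  is_tree e -> exists sigma : 'cV[R]_n, signed_according e sigma.
Proof.
move=> tree; have [_ sym irr _ _] := tree.
have [colour alt] := subtree_colouring sym irr (tree_subtree tree).
exists (\col_i (-1) ^+ colour i); split=> [i|i j ij]; rewrite !mxE.
  by case: (colour i); [right | left].
by rewrite (alt i j) ?inE //; case: (colour j); rewrite ?opprK.
Qed.

Theorem mainTheorem3 (R : realType) (n : nat) (T : rel 'I_n) (A : 'M[R]_n)
    (hT : is_tree T)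
    (hTP : T_TP T A)
    (hP : forall p : 'I_n, pendent T p -> P_matrix (delete_vertex A p))
    (hdet : 0 < \det A) :
  exists lam : R,
    [/\ 0 < lam,
        eigenvalue (complexify A) lam%:C,
        mup lam%:C (char_poly (complexify A)) = 1%N,
        (forall mu : R[i], eigenvalue (complexify A) mu -> mu != lam%:C ->
           lam%:C < `|mu|)
      & exists sigma x : 'cV[R]_n,
          [/\ signed_according T sigma,
              A *m x = lam *: x
            & forall i : 'I_n, 0 < sigma i 0 * x i 0]].
Proof.
have [n0 _ _ _ _] := hT; have [sigma sigT] := tree_signing R hT.
have [sig _] := sigT.
have U : A \in unitmx by rewrite unitmxE unitfE gt_eqF.
have pos := subtree_inverse_positive hT hTP sigT hP hdet (tree_subtree hT)
  (or_introl erefl).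
have invE : invmx (restr (sign_conj sigma A) setT) = sign_conj sigma (invmx A).
  have -> : restr (sign_conj sigma A) setT = sign_conj sigma A.
    by apply/matrixP => i j; rewrite !mxE !inE.
  have DD := sign_diag_involutive sig.
  have inv : sign_conj sigma A *m sign_conj sigma (invmx A) = 1%:M.
    rewrite !sign_conjE !mulmxA -[_ *m _ *m diag_mx _ *m diag_mx _]mulmxA DD.
    by rewrite mulmx1 -[_ *m A *m _]mulmxA mulmxV // mulmx1 DD.
  have [UA _] := mulmx1_unit inv.
  by rewrite -[RHS](mulKmx UA) inv mulmx1.
have [|lam [x [[lam0 eig] simple dom Ax sx]]] :=
  signed_inverse_spectrum n0 sig (mulmxV U).
  by move=> i j; have := pos i j; rewrite invE !inE mxE; apply.
by exists lam; split=> //; exists sigma, x.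
Qed.
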